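(* Let $X=(X_t)_{t\ge0}$ be any discrete-time stationary reversible Markov chain on any measurable state space $S$, let $d\ge1$, and let $\mathbf f$ be any measurable function from $S$ to $\mathbb R^d$ such that $\mathbf f(X_0)\in L^2$. Then $$\operatorname{trCov}(\mathbf f(X_0),\mathbf f(X_t))\ge0$$ for any even value of $t\ge0$.
   Context: Stationary reversible: $X$ is a time-homogeneous Markov chain with transition kernel $K$ and the law $\mu$ of $X_0$ satisfies $\mu(dx)K(x,dy)=\mu(dy)K(y,dx)$ as measures on $S\times S$; so each $X_t$ has law $\mu$. $\mathbf f(X_0)\in L^2$ means $\mathbb E\|\mathbf f(X_0)\|^2<\infty$ (Euclidean norm). For random vectors $\mathbf Y,\tilde{\mathbf Y}\in L^2$ in $\mathbb R^d$, $\operatorname{trCov}(\mathbf Y,\tilde{\mathbf Y})=\sum_{i=1}^d\operatorname{Cov}(Y_i,\tilde Y_i)$. *)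

(* Defs.v *)
From HB Require Import structures.
From mathcomp Require Import all_boot all_order all_algebra.
From mathcomp Require Import all_classical all_reals all_analysis.

Set Implicit Arguments.
Unset Strict Implicit.
Unset Printing Implicit Defensive.
Import Order.TTheory GRing.Theory Num.Theory.

Local Open Scope classical_set_scope.
Local Open Scope ring_scope.
Local Open Scope ereal_scope.

(* Markov property with respect to the natural filtration: the hypothesis on A
   says A \in sigma(X_0, ..., X_t), and the conclusion is the defining property
   of P(X_{t+1} \in B | X_0, ..., X_t) = K(X_t, B) almost surely. *)
Definition markov_chain (dT dS : measure_display) (T : measurableType dT)
    (S : measurableType dS) (R : realType) (P : probability T R)
    (K : R.-pker S ~> S) (X : nat -> {RV P >-> S}) : Prop :=
  forall (t : nat) (A : set T) (B : set S),
    g_sigma_preimage (fun i : 'I_t.+1 => (X i : T -> S)) A -> measurable B ->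
    P (A `&` X t.+1 @^-1` B) = \int[P]_(w in A) K (X t w) B.

(* Equality of the measures mu(dx) K(x, dy) and mu(dy) K(y, dx) at C. *)
Definition reversible (dS : measure_display) (S : measurableType dS)
    (R : realType) (mu : {measure set S -> \bar R}) (K : R.-pker S ~> S)
    : Prop :=
  forall C : set (S * S), measurable C ->
    \int[mu]_x K x (xsection C x) = \int[mu]_y K y (ysection C y).

(* R^d is d.-tuple R: its measurable structure is the one generated by the
   coordinates, i.e. the Borel sigma-algebra. *)
Definition euclidean_norm (R : realType) (d : nat) (v : d.-tuple R) : R :=
  Num.sqrt (\sum_(i < d) tnth v i ^+ 2)%R.

Definition square_integrable (dT : measure_display) (T : measurableType dT)
    (R : realType) (P : probability T R) (d : nat) (Y : T -> d.-tuple R)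
    : Prop :=
  'E_P[fun w => (euclidean_norm (Y w) ^+ 2)%R] < +oo.

Definition trCov (dT : measure_display) (T : measurableType dT)
    (R : realType) (P : probability T R) (d : nat) (Y Z : T -> d.-tuple R)
    : \bar R :=
  \sum_(i < d) covariance P (fun w => tnth (Y w) i) (fun w => tnth (Z w) i).

(* Main.v *)
Require Import Defs.
From HB Require Import structures.
From mathcomp Require Import all_boot all_order all_algebra.
From mathcomp Require Import all_classical all_reals all_analysis.
From mathcomp Require Import measurable_realfun ring lra.
Set Implicit Arguments.
Unset Strict Implicit.
Unset Printing Implicit Defensive.
Import Order.TTheory GRing.Theory Num.Theory.
Import HBNNSimple.
Local Open Scope classical_set_scope.
Local Open Scope ring_scope.
Local Open Scope ereal_scope.

(** The mechanism is that an even-lag correlation is a square.  Write [mu] for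
    the law of [X 0], [Q h x = \int h(y) K(x, dy)] for the transition operator,
    and centre a coordinate of [f] to get a real function [g].  The Markov
    property gives [E[g(X_0) h(X_t)] = \int g . Q^t h dmu]
    ([markov_chain_iter]), and reversibility says that [Q] is self-adjoint with
    respect to [mu] ([reversible_kernel_op_sym]), so that for [t = 2 s] the
    correlation [E[g(X_0) g(X_t)]] equals [\int (Q^s g)^2 dmu >= 0].

    Integrals of functions with values in [[0, +oo]] always make sense, so all
    identities are proved for nonnegative functions, where no integrability
    has to be carried through the iterates of [Q].  The signed [g] enters only
    at the end ([even_lag_autocorrelation_ge0]): with [u = Q^s g^+] and
    [v = Q^s g^-], the positive and negative parts of [g(X_0) g(X_t)] integrate
    to [\int (u u + v v) dmu] and [\int (u v + v u) dmu], and
    [u v + v u <= u u + v v] pointwise.  Square integrability makes the second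
    integral finite, so that the difference is meaningful.

    The Markov property and reversibility are given on measurable sets.  They
    are lifted to functions, one argument at a time, by
    [eq_integral_weighted_mixture]: two weighted mixtures of measures that
    agree on measurable sets integrate every nonnegative measurable function
    equally.  A Dirac kernel in the mixture turns evaluation at a random point
    into such a mixture, which lets this single lemma serve every case. *)

(** * Mixtures of measures *)

(** A constant factor commutes with limits even when it is [+oo], because the
    sequence is nondecreasing: either its limit is 0 and all its terms vanish,
    or its terms are eventually positive and the product is eventually [+oo].
    Weights such as [Q h] can be infinite, hence the need for this case. *)
Lemma ge0_cvgeZl (R : realType) (c : \bar R) (a : nat -> \bar R) (l : \bar R) :
  0 <= c -> (forall n, 0 <= a n) -> {homo a : m n / (m <= n)%N >-> m <= n} ->
  a n @[n --> \oo] --> l -> c * a n @[n --> \oo] --> c * l.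
Proof.
move=> c0 a0 nda al.
case: (boolP (c \is a fin_num)) => [cfin|]; first exact: cvgeZl.
rewrite ge0_fin_numE// -leNgt leye_eq => /eqP ->.
have aEl n : a n <= l.
  have /(cvg_lim (@ereal_hausdorff R)) lE := ereal_nondecreasing_cvgn nda.
  have := cvg_lim (@ereal_hausdorff R) al; rewrite lE => <-.
  by apply: ereal_sup_ubound; exists n.
have l0 : 0 <= l := le_trans (a0 0%N) (aEl 0%N).
move: l0; rewrite le_eqVlt => /predU1P[l0|l0].
  have aE n : a n = 0 by apply/eqP; rewrite eq_le a0 andbT [leRHS]l0 aEl.
  under eq_fun do rewrite aE.
  by rewrite -l0; exact: cvg_cst.
rewrite gt0_mulye//; apply: cvg_near_cst.
have [N _ aN] := al _ (open_ereal_gt' l0).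
by exists N => // n /= Nn; rewrite gt0_mulye//; exact: aN.
Qed.

Section weighted_mixture.
Context {d1 d2 d' : measure_display} {T1 : measurableType d1}
  {T2 : measurableType d2} {S : measurableType d'} {R : realType}.

(** Linearity over the level sets of a simple function: the right-hand side
    depends on the mixture only through its values on measurable sets. *)
Lemma ge0_integral_weighted_fsum (d : measure_display) (T : measurableType d)
    (mu : {measure set T -> \bar R}) (w : T -> \bar R)
    (k : T -> {measure set S -> \bar R}) (h : {nnsfun S >-> R}) :
  (forall x, 0 <= w x) -> measurable_fun [set: T] w ->
  (forall B, measurable B -> measurable_fun [set: T] (k ^~ B)) ->
  \int[mu]_x (w x * \int[k x]_y (h y)%:E) =
  \sum_(r \in range h)
    (r%:E * \int[mu]_x (w x * k x (h @^-1` [set r]))).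
Proof.
move=> w0 mw mk.
have wk0 r x : 0 <= w x * k x (h @^-1` [set r]) by rewrite mule_ge0.
have mwk r : measurable_fun [set: T] (fun x => w x * k x (h @^-1` [set r])).
  by apply: emeasurable_funM => //; exact: mk.
have rwk0 r x : 0 <= r%:E * (w x * k x (h @^-1` [set r])).
  have [r0|r0] := leP 0%R r; first by rewrite mule_ge0.
  (* a negative value is not attained, so its level set is empty *)
  by rewrite preimage_nnfun0// measure0 mule0 mule0.
transitivity (\int[mu]_x
    (\sum_(r \in range h) (r%:E * (w x * k x (h @^-1` [set r]))))).
  apply: eq_integral => x _.
  rewrite integralT_nnsfun sintegralE ge0_mule_fsumr.
    by apply: eq_fsbigr => r _; rewrite muleCA.
  by move=> r; exact: nnsfun_mulemu_ge0.
rewrite ge0_integral_fsum//; last first.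
  by move=> r; apply: emeasurable_funM.
apply: eq_fsbigr => r /[!inE] -[y _ <-].
by rewrite ge0_integralZl// lee_fin.
Qed.

(** Monotone convergence, once inside each [k x] and once over [mu]. *)
Lemma ge0_integral_weighted_cvg (d : measure_display) (T : measurableType d)
    (mu : {measure set T -> \bar R}) (w : T -> \bar R)
    (k : T -> {measure set S -> \bar R}) (h : S -> \bar R)
    (mh : measurable_fun [set: S] h) :
  (forall x, 0 <= w x) -> measurable_fun [set: T] w ->
  (forall B, measurable B -> measurable_fun [set: T] (k ^~ B)) ->
  (forall y, 0 <= h y) ->
  \int[mu]_x (w x * \int[k x]_y (nnsfun_approx measurableT mh n y)%:E)
    @[n --> \oo] --> \int[mu]_x (w x * \int[k x]_y h y).
Proof.
move=> w0 mw mk h0.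
set g := fun n => nnsfun_approx measurableT mh n.
have g0 n y : 0 <= (g n y)%:E by rewrite lee_fin.
have mg n : measurable_fun [set: S] (fun y => (g n y)%:E).
  exact/measurable_EFinP.
have ndg y : {homo (fun n => (g n y)%:E) : m n / (m <= n)%N >-> m <= n}.
  by move=> m n mn; rewrite lee_fin; exact/lefP/nd_nnsfun_approx.
have kg0 n x : 0 <= \int[k x]_y (g n y)%:E by exact: integral_ge0.
have ndkg x :
    {homo (fun n => \int[k x]_y (g n y)%:E) : m n / (m <= n)%N >-> m <= n}.
  by move=> m n mn; apply: ge0_le_integral => // y _; exact: ndg.
have kgcvg x : \int[k x]_y (g n y)%:E @[n --> \oo] --> \int[k x]_y h y.
  rewrite (_ : \int[k x]_y h y = \int[k x]_y limn (fun n => (g n y)%:E)).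
    by apply: cvg_monotone_convergence => // y _; exact: ndg.
  apply: eq_integral => y _; apply/esym/cvg_lim => //.
  exact: cvg_nnsfun_approx.
rewrite (_ : \int[mu]_x (w x * \int[k x]_y h y) =
    \int[mu]_x limn (fun n => w x * \int[k x]_y (g n y)%:E)).
  apply: cvg_monotone_convergence => //.
  - move=> n; apply: emeasurable_funM => //.
    exact: measurable_fun_integral_kernel.
  - by move=> n x _; rewrite mule_ge0.
  - by move=> x _ m n mn; apply: lee_wpmul2l => //; exact: ndkg.
apply: eq_integral => x _; apply/esym/cvg_lim => //.
exact: ge0_cvgeZl.
Qed.

(** The approximating simple functions do not depend on the mixture, so the
    two sides agree at each stage of the approximation and hence in the limit.
    The weights are [\bar R]-valued so that one function argument of a bilinear
    expression can serve as the weight while the other one is being lifted from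
    indicators. *)
Lemma eq_integral_weighted_mixture
    (mu1 : {measure set T1 -> \bar R}) (mu2 : {measure set T2 -> \bar R})
    (w1 : T1 -> \bar R) (w2 : T2 -> \bar R)
    (k1 : T1 -> {measure set S -> \bar R})
    (k2 : T2 -> {measure set S -> \bar R}) (h : S -> \bar R) :
  (forall x, 0 <= w1 x) -> measurable_fun [set: T1] w1 ->
  (forall x, 0 <= w2 x) -> measurable_fun [set: T2] w2 ->
  (forall B, measurable B -> measurable_fun [set: T1] (k1 ^~ B)) ->
  (forall B, measurable B -> measurable_fun [set: T2] (k2 ^~ B)) ->
  (forall B, measurable B ->
    \int[mu1]_x (w1 x * k1 x B) = \int[mu2]_x (w2 x * k2 x B)) ->
  (forall y, 0 <= h y) -> measurable_fun [set: S] h ->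
  \int[mu1]_x (w1 x * \int[k1 x]_y h y) =
  \int[mu2]_x (w2 x * \int[k2 x]_y h y).
Proof.
move=> w10 mw1 w20 mw2 mk1 mk2 eqB h0 mh.
have := @ge0_integral_weighted_cvg _ _ mu1 _ _ _ mh w10 mw1 mk1 h0.
under eq_fun => n.
  rewrite ge0_integral_weighted_fsum//.
  under eq_fsbigr do rewrite eqB//.
  rewrite -ge0_integral_weighted_fsum//.
  over.
move=> /(cvg_lim (@ereal_hausdorff R)) <-.
apply: cvg_lim => //.
exact: ge0_integral_weighted_cvg.
Qed.

End weighted_mixture.

Lemma measurable_fun_dirac (dT dS : measure_display) (T : measurableType dT)
    (S : measurableType dS) (R : realType) (X : T -> S) (B : set S) :
  measurable_fun [set: T] X -> measurable B ->
  measurable_fun [set: T] (fun w => (\d_(X w) B : \bar R)).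
Proof.
move=> mX mB.
have mdB : measurable_fun [set: S] (fun x => (\d_x B : \bar R)).
  by apply/measurable_EFinP; exact: measurable_indic.
exact: (measurableT_comp mdB mX).
Qed.

(** * The transition operator *)

Section kernel_op.
Context {d : measure_display} {S : measurableType d} {R : realType}.
Context (K : R.-pker S ~> S).
Implicit Types (g h : S -> \bar R).

Definition kernel_op h (x : S) : \bar R := \int[K x]_y h y.

Lemma kernel_op_ge0 h :
  (forall x, 0 <= h x) -> forall x, 0 <= kernel_op h x.
Proof. by move=> h0 x; apply: integral_ge0 => y _; exact: h0. Qed.

Lemma measurable_kernel_op h : (forall x, 0 <= h x) ->
  measurable_fun [set: S] h -> measurable_fun [set: S] (kernel_op h).
Proof.
move=> h0 mh; apply: measurable_fun_integral_kernel => // U mU.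
exact: measurable_kernel.
Qed.

Lemma iter_kernel_op_ge0 n h :
  (forall x, 0 <= h x) -> forall x, 0 <= iter n kernel_op h x.
Proof. by move=> h0; elim: n => [//|n IHn] /=; exact: kernel_op_ge0. Qed.

Lemma measurable_iter_kernel_op n h : (forall x, 0 <= h x) ->
  measurable_fun [set: S] h -> measurable_fun [set: S] (iter n kernel_op h).
Proof.
move=> h0 mh; elim: n => [//|n IHn] /=; apply: measurable_kernel_op => //.
exact: iter_kernel_op_ge0.
Qed.

Lemma iter_kernel_op1 n : iter n kernel_op (cst 1) = cst 1.
Proof.
elim: n => [//|n IHn] /=; rewrite IHn; apply/funext => x.
by rewrite /kernel_op integral_cst// mul1e prob_kernel.
Qed.

(** Self-adjointness of the operator in [L^2 mu], for nonnegative functions.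
    Reversibility on rectangles [A `*` B] is the case of two indicators;
    [half] lifts the indicator of [B] to [h], and the rest of the proof lifts
    that of [A] to [g]. *)
Lemma reversible_kernel_op_sym (mu : {measure set S -> \bar R}) g h :
  reversible mu K ->
  (forall x, 0 <= g x) -> measurable_fun [set: S] g ->
  (forall x, 0 <= h x) -> measurable_fun [set: S] h ->
  \int[mu]_x (g x * kernel_op h x) = \int[mu]_x (kernel_op g x * h x).
Proof.
move=> revK g0 mg h0 mh.
have mK B : measurable B -> measurable_fun [set: S] (K ^~ B).
  by move=> mB; exact: measurable_kernel.
have mdS B : measurable B ->
    measurable_fun [set: S] (fun y => (\d_y B : \bar R)).
  by move=> mB; exact: measurable_fun_dirac.
have Qh0 x : 0 <= kernel_op h x by exact: kernel_op_ge0.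
have mQh : measurable_fun [set: S] (kernel_op h).
  exact: measurable_kernel_op.
have rect A B : measurable A -> measurable B ->
    \int[mu]_x (\d_x A * K x B) = \int[mu]_y (K y A * \d_y B).
  move=> mA mB; have := revK _ (measurableX mA mB).
  congr (_ = _); apply: eq_integral => x _; rewrite diracE.
    have [xA|xA] := boolP (x \in A).
      by rewrite in_xsectionX// mul1e.
    by rewrite notin_xsectionX// measure0 mul0e.
  have [xB|xB] := boolP (x \in B).
    by rewrite in_ysectionX// mule1.
  by rewrite notin_ysectionX// measure0 mule0.
have half A : measurable A ->
    \int[mu]_x (kernel_op h x * \d_x A) = \int[mu]_y (h y * K y A).
  move=> mA; under eq_integral do rewrite muleC.
  rewrite (@eq_integral_weighted_mixture _ _ _ _ _ _ _ _ mu _ (K ^~ A) K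
    (fun y => \d_y))//.
  - by apply: eq_integral => y _; rewrite integral_dirac// diracT mul1e muleC.
  - exact: mdS.
  - exact: mK.
  - by move=> B mB; exact: rect.
under eq_integral => x _ do
  rewrite muleC -[g x]mul1e -(diracT R x) -integral_dirac//.
rewrite (@eq_integral_weighted_mixture _ _ _ _ _ _ _ _ mu _ h _ K)//.
by apply: eq_integral => y _; rewrite muleC.
Qed.

Lemma reversible_iter_kernel_op (mu : {measure set S -> \bar R}) g h m n :
  reversible mu K ->
  (forall x, 0 <= g x) -> measurable_fun [set: S] g ->
  (forall x, 0 <= h x) -> measurable_fun [set: S] h ->
  \int[mu]_x (g x * iter (m + n) kernel_op h x) =
  \int[mu]_x (iter m kernel_op g x * iter n kernel_op h x).
Proof.
move=> revK + + h0 mh; elim: m g => [//|m IHm] g g0 mg.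
rewrite addSn iterS reversible_kernel_op_sym//; last 2 first.
- exact: iter_kernel_op_ge0.
- exact: measurable_iter_kernel_op.
rewrite IHm; last 2 first.
- exact: kernel_op_ge0.
- exact: measurable_kernel_op.
by rewrite -iterSr.
Qed.

End kernel_op.

(** * Correlations along the chain *)

Section markov_chain.
Context {dT dS : measure_display} {T : measurableType dT}
  {S : measurableType dS} {R : realType}.
Context {P : probability T R} {K : R.-pker S ~> S} {X : nat -> {RV P >-> S}}.
Context (markovX : markov_chain K X).
Implicit Types (g h : S -> \bar R).

(** One step of the chain replaces [h] by [Q h].  Only events of the form
    [X 0 \in A] are used from the past of the chain, which is enough to keep
    the factor [g (X 0)] through an induction on time. *)
Lemma markov_chain_step t g h :
  (forall x, 0 <= g x) -> measurable_fun [set: S] g ->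
  (forall x, 0 <= h x) -> measurable_fun [set: S] h ->
  \int[P]_w (g (X 0%N w) * h (X t.+1 w)) =
  \int[P]_w (g (X 0%N w) * kernel_op K h (X t w)).
Proof.
move=> g0 mg h0 mh.
have mX n : measurable_fun [set: T] (X n) by [].
have mKX n B : measurable B -> measurable_fun [set: T] (fun w => K (X n w) B).
  by move=> mB; have := measurableT_comp (measurable_kernel K B mB) (mX n).
have Qh0 x : 0 <= kernel_op K h x by exact: kernel_op_ge0.
have mQh : measurable_fun [set: S] (kernel_op K h).
  exact: measurable_kernel_op.
have rect A B : measurable A -> measurable B ->
    \int[P]_w (\d_(X 0%N w) A * \d_(X t.+1 w) B) =
    \int[P]_w (\d_(X 0%N w) A * K (X t w) B).
  move=> mA mB.
  transitivity (P (X 0%N @^-1` A `&` X t.+1 @^-1` B)).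
    rewrite -[X in P X]setIT -integral_indic//; last by apply: measurableI;
      rewrite -[_ @^-1` _]setTI; exact: mX.
    apply: eq_integral => w _.
    by rewrite indicI EFinM.
  rewrite markovX//; last first.
    apply: sub_sigma_algebra; apply: (@bigsetU_sup _ 0 t.+1
      (fun i => preimage_set_system setT (X i : T -> S) measurable)) => //.
    by exists A => //; rewrite setTI.
  rewrite integral_mkcond; apply: eq_integral => w _.
  by rewrite patchE diracE -[X in if X then _ else _]/(X 0%N w \in A);
      case: (X 0%N w \in A); rewrite ?mul1e ?mul0e.
have half A : measurable A ->
    \int[P]_w (h (X t.+1 w) * \d_(X 0%N w) A) =
    \int[P]_w (kernel_op K h (X t w) * \d_(X 0%N w) A).
  move=> mA.
  transitivity (\int[P]_w (\d_(X 0%N w) A * \int[\d_(X t.+1 w)]_y h y)).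
    by apply: eq_integral => w _; rewrite integral_dirac// diracT mul1e muleC.
  rewrite (@eq_integral_weighted_mixture _ _ _ _ _ _ _ _ P _
    (fun w => \d_(X 0%N w) A) _ (fun w => K (X t w)))//.
  - by apply: eq_integral => w _; rewrite muleC.
  - exact: measurable_fun_dirac.
  - exact: measurable_fun_dirac.
  - by move=> B mB; exact: measurable_fun_dirac.
  - exact: mKX.
  - by move=> B mB; exact: rect.
have gE w : g (X 0%N w) = \int[\d_(X 0%N w)]_x g x.
  by rewrite integral_dirac// diracT mul1e.
under eq_integral do rewrite muleC gE.
under [RHS]eq_integral do rewrite muleC gE.
apply: eq_integral_weighted_mixture => //.
- exact: measurableT_comp.
- exact: measurableT_comp.
- by move=> B mB; exact: measurable_fun_dirac.
- by move=> B mB; exact: measurable_fun_dirac.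
Qed.

Lemma markov_chain_iter t g h :
  (forall x, 0 <= g x) -> measurable_fun [set: S] g ->
  (forall x, 0 <= h x) -> measurable_fun [set: S] h ->
  \int[P]_w (g (X 0%N w) * h (X t w)) =
  \int[distribution P (X 0%N)]_x (g x * iter t (kernel_op K) h x).
Proof.
move=> g0 mg + +; elim: t h => [|t IHt] h h0 mh.
  rewrite ge0_integral_distribution//.
    exact: emeasurable_funM.
  by move=> x; rewrite mule_ge0.
rewrite markov_chain_step// IHt; last 2 first.
- exact: kernel_op_ge0.
- exact: measurable_kernel_op.
by rewrite -iterSr.
Qed.

End markov_chain.

(** The positive part of a product, in terms of the positive and negative parts
    of its factors; replacing [b] by [- b] gives its negative part. *)
Lemma maxr0M (R : realDomainType) (a b : R) :
  (Num.max (a * b) 0 =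
   Num.max a 0 * Num.max b 0 + Num.max (- a) 0 * Num.max (- b) 0)%R.
Proof.
have [a0|a0] := lerP 0%R a; have [b0|b0] := lerP 0%R b.
- rewrite (@max_r _ _ (- a)%R) ?oppr_le0// mul0r addr0.
  by rewrite !max_l// mulr_ge0.
- rewrite (@max_r _ _ (- a)%R) ?oppr_le0// mul0r addr0 mulr0.
  by rewrite max_r// mulr_ge0_le0// ltW.
- rewrite (@max_r _ _ (- b)%R) ?oppr_le0// mul0r mulr0 addr0.
  by rewrite max_r// mulr_le0_ge0// ltW.
- rewrite mul0r add0r !max_l ?oppr_ge0 ?mulrNN ?(ltW a0) ?(ltW b0)//.
  by rewrite mulr_le0// ltW.
Qed.

Lemma ge0_lee_addMM (R : realDomainType) (u v : \bar R) :
  0 <= u -> 0 <= v -> u * v + v * u <= u * u + v * v.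
Proof.
move: u v => [u| |] [v| |] //= u0 v0.
- rewrite -!EFinM -!EFinD lee_fin -subr_ge0.
  rewrite (_ : _ - _ = (u - v) ^+ 2)%R ?sqr_ge0//.
  by ring.
- by rewrite mulyy addey ?leey// -EFinM.
- by rewrite mulyy addye ?leey// -EFinM.
Qed.

Section stationary_reversible.
Context {dT dS : measure_display} {T : measurableType dT}
  {S : measurableType dS} {R : realType}.
Context {P : probability T R} {K : R.-pker S ~> S} {X : nat -> {RV P >-> S}}.
Context (markovX : markov_chain K X).
Context (revX : reversible (distribution P (X 0%N)) K).

(** Self-adjointness moves all the iterates of the operator onto the constant
    function 1, which they fix since [K] has total mass 1. *)
Lemma stationary_ge0_integral t (h : S -> \bar R) :
  (forall x, 0 <= h x) -> measurable_fun [set: S] h ->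
  \int[P]_w h (X t w) = \int[P]_w h (X 0%N w).
Proof.
move=> h0 mh.
transitivity (\int[P]_w (cst 1 (X 0%N w) * h (X t w))).
  by apply: eq_integral => w _; rewrite mul1e.
rewrite (markov_chain_iter markovX)//.
rewrite -(addn0 t) reversible_iter_kernel_op// iter_kernel_op1.
rewrite -ge0_integral_distribution//.
by apply: eq_integral => x _; rewrite mul1e.
Qed.

Lemma stationary_expectation t (g : S -> R) : measurable_fun [set: S] g ->
  'E_P[g \o X t] = 'E_P[g \o X 0%N].
Proof.
move=> mg; rewrite unlock integralE [RHS]integralE.
have mg' : measurable_fun [set: S] (EFin \o g) by exact/measurable_EFinP.
congr (_ - _).
- under eq_integral do rewrite funeposE.
  under [RHS]eq_integral do rewrite funeposE.
  apply: (@stationary_ge0_integral t (fun x => maxe (g x)%:E 0)).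
    by move=> x; rewrite le_max lexx orbT.
  by apply: measurable_maxe.
- under eq_integral do rewrite funenegE.
  under [RHS]eq_integral do rewrite funenegE.
  apply: (@stationary_ge0_integral t (fun x => maxe (- (g x)%:E) 0)).
    by move=> x; rewrite le_max lexx orbT.
  by apply: measurable_maxe => //; exact: measurableT_comp.
Qed.

(** The correlation is [\int (u - v)^2 dmu], where [u] and [v] are the images
    under [s] transitions of the positive and negative parts of [g]; as [u] and
    [v] may be infinite, the square is kept expanded.  The bound
    [|a b| <= a^2 + b^2] and stationarity give the finiteness of the negative
    part of the integral, without which the difference could be [+oo - +oo],
    that is [-oo]. *)
Lemma even_lag_autocorrelation_ge0 s (g : S -> R) :
  measurable_fun [set: S] g ->
  \int[P]_w (g (X 0%N w) ^+ 2)%:E < +oo ->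
  0 <= \int[P]_w (g (X 0%N w) * g (X (s + s)%N w))%:E.
Proof.
move=> mg gL2.
set t := (s + s)%N.
pose p (a : R) : \bar R := (Num.max a 0)%:E.
have p0 a : 0 <= p a by rewrite lee_fin le_max lexx orbT.
have mp (U : measurableType _) (f : U -> R) : measurable_fun [set: U] f ->
    measurable_fun [set: U] (fun x => p (f x)).
  by move=> mf; apply/measurable_EFinP; exact: measurable_maxr.
have mgN : measurable_fun [set: S] (\- g)%R.
  exact: (measurableT_comp (@oppr_measurable R setT) mg).
pose gp x := p (g x); pose gn x := p (- g x)%R.
have gp0 x : 0 <= gp x by exact: p0.
have gn0 x : 0 <= gn x by exact: p0.
have mgp : measurable_fun [set: S] gp by exact: mp.
have mgn : measurable_fun [set: S] gn by exact: (mp _ _ _ mgN).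
have mX n : measurable_fun [set: T] (X n) by [].
have mcomp n (h : S -> \bar R) :
    measurable_fun [set: S] h -> measurable_fun [set: T] (h \o X n).
  by move=> mh; exact: (measurableT_comp mh (mX n)).
pose I (h k : S -> \bar R) := \int[P]_w (h (X 0%N w) * k (X t w)).
pose F w := (g (X 0%N w) * g (X t w))%:E.
have posE : \int[P]_w F^\+ w = I gp gp + I gn gn.
  rewrite -ge0_integralD//=; last 4 first.
  - by move=> w _; rewrite mule_ge0.
  - by apply: emeasurable_funM; exact: mcomp.
  - by move=> w _; rewrite mule_ge0.
  - by apply: emeasurable_funM; exact: mcomp.
  apply: eq_integral => w _.
  by rewrite funeposE /F /gp /gn /p -!EFinM -EFinD -maxr0M -EFin_max.
have negE : \int[P]_w F^\- w = I gp gn + I gn gp.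
  rewrite -ge0_integralD//=; last 4 first.
  - by move=> w _; rewrite mule_ge0.
  - by apply: emeasurable_funM; exact: mcomp.
  - by move=> w _; rewrite mule_ge0.
  - by apply: emeasurable_funM; exact: mcomp.
  apply: eq_integral => w _.
  rewrite funenegE /F /gp /gn /p -!EFinM -EFinD -EFinN -!EFin_max.
  by have := maxr0M (g (X 0%N w)) (- g (X t w)); rewrite opprK mulrN => <-.
have neg_fin : \int[P]_w F^\- w < +oo.
  pose G w := (g (X 0%N w) ^+ 2)%:E + (g (X t w) ^+ 2)%:E.
  have mg2 n : measurable_fun [set: T] (fun w => (g (X n w) ^+ 2)%:E).
    apply/measurable_EFinP; apply: measurable_funX.
    exact: (measurableT_comp mg).
  apply: (@le_lt_trans _ _ (\int[P]_w G w)).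
    apply: ge0_le_integral => //.
    - apply: measurable_funeneg; apply/measurable_EFinP.
      by apply: measurable_funM; exact: (measurableT_comp mg).
    - exact: emeasurable_funD.
    - move=> w _; rewrite funenegE /F /G -EFinN -EFin_max -EFinD lee_fin.
      rewrite ge_max addr_ge0 ?sqr_ge0// andbT.
      set a := g _; set b := g _.
      have := sqr_ge0 (a + b); have := sqr_ge0 a; have := sqr_ge0 b.
      by rewrite !expr2; nra.
  rewrite ge0_integralD//; last 2 first.
  - by move=> w _; rewrite lee_fin sqr_ge0.
  - by move=> w _; rewrite lee_fin sqr_ge0.
  rewrite (@stationary_ge0_integral t (fun x => (g x ^+ 2)%:E)).
  - by rewrite lte_add_pinfty.
  - by move=> x; rewrite lee_fin sqr_ge0.
  - by apply/measurable_EFinP; exact: measurable_funX.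
rewrite integralE sube_ge0; last first.
  by rewrite ge0_fin_numE ?neg_fin// integral_ge0.
rewrite posE negE /I !(markov_chain_iter markovX)//.
rewrite !reversible_iter_kernel_op//.
set u := iter s _ gp; set v := iter s _ gn.
have u0 x : 0 <= u x by exact: iter_kernel_op_ge0.
have v0 x : 0 <= v x by exact: iter_kernel_op_ge0.
have m_u : measurable_fun [set: S] u by exact: measurable_iter_kernel_op.
have m_v : measurable_fun [set: S] v by exact: measurable_iter_kernel_op.
rewrite -!ge0_integralD//; try by [move=> x _; rewrite mule_ge0|
  exact: emeasurable_funM].
apply: ge0_le_integral => //.
- by move=> x _; rewrite adde_ge0 ?mule_ge0.
- by apply: emeasurable_funD; exact: emeasurable_funM.
- by apply: emeasurable_funD; exact: emeasurable_funM.
- by move=> x _; exact: ge0_lee_addMM.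
Qed.

End stationary_reversible.

(** * Coordinates of a vector-valued function *)

Lemma sqr_euclidean_norm (R : realType) (d : nat) (v : d.-tuple R) :
  (euclidean_norm v ^+ 2 = \sum_(i < d) tnth v i ^+ 2)%R.
Proof. by rewrite sqr_sqrtr// sumr_ge0// => i _; exact: sqr_ge0. Qed.

(** This is [(y - m)^2 <= 2 y^2 + 2 m^2], which amounts to
    [0 <= (y + m)^2]. *)
Lemma integral_sqrB_lty (dT : measure_display) (T : measurableType dT)
    (R : realType) (P : probability T R) (Y : T -> R) (m : R) :
  measurable_fun [set: T] Y -> \int[P]_w (Y w ^+ 2)%:E < +oo ->
  \int[P]_w ((Y w - m) ^+ 2)%:E < +oo.
Proof.
move=> mY Y2.
have mY2 : measurable_fun [set: T] (fun w => (Y w ^+ 2)%:E).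
  by apply/measurable_EFinP; exact: measurable_funX.
apply: (@le_lt_trans _ _
    (\int[P]_w (2%:E * (Y w ^+ 2)%:E + cst (2 * m ^+ 2)%:E w))).
  apply: ge0_le_integral => //.
  - by move=> w _; rewrite lee_fin sqr_ge0.
  - apply/measurable_EFinP; apply: measurable_funX.
    exact: measurable_funB.
  - by apply: emeasurable_funD => //; exact: emeasurable_funM.
  - move=> w _; rewrite /= -EFinM -EFinD lee_fin.
    by have := sqr_ge0 (Y w + m); rewrite !expr2; nra.
rewrite ge0_integralD//; last 3 first.
- by move=> w _; rewrite -EFinM lee_fin mulr_ge0// sqr_ge0.
- by apply: emeasurable_funM.
- by move=> w _; rewrite lee_fin mulr_ge0// sqr_ge0.
rewrite ge0_integralZl//; last by move=> w _; rewrite lee_fin sqr_ge0.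
rewrite integral_cst//= probability_setT mule1 lte_add_pinfty ?ltry//.
by rewrite lte_mul_pinfty.
Qed.

Theorem theorem6p1 (R : realType) (dT dS : measure_display)
    (T : measurableType dT) (S : measurableType dS) (P : probability T R)
    (K : R.-pker S ~> S) (X : nat -> {RV P >-> S})
    (markovX : markov_chain K X)
    (revX : reversible (distribution P (X 0%N)) K)
    (d : nat) (d_gt0 : (0 < d)%N)
    (f : S -> d.-tuple R) (mf : measurable_fun [set: S] f)
    (f_L2 : square_integrable P (f \o X 0%N))
    (t : nat) (t_even : ~~ odd t) :
  0 <= trCov P (f \o X 0%N) (f \o X t).
Proof.
apply: sume_ge0 => i _.
pose fi x := tnth (f x) i.
have mfi j : measurable_fun [set: S] (fun x => tnth (f x) j).
  exact: (measurableT_comp (measurable_tnth j)).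
have mfiX n j : measurable_fun [set: T] (fun w => tnth (f (X n w)) j).
  exact: (measurableT_comp (mfi j)).
have fi_L2 : \int[P]_w (fi (X 0%N w) ^+ 2)%:E < +oo.
  move: f_L2; rewrite /square_integrable unlock; apply: le_lt_trans.
  apply: ge0_le_integral => //.
  - by move=> w _; rewrite lee_fin sqr_ge0.
  - by apply/measurable_EFinP; exact: (measurable_funX _ (mfiX 0%N i)).
  - apply/measurable_EFinP; under eq_fun do rewrite sqr_euclidean_norm.
    by apply: measurable_sum => j; exact: (measurable_funX _ (mfiX 0%N j)).
  - move=> w _; rewrite lee_fin sqr_euclidean_norm (bigD1 i)//= lerDl.
    by rewrite sumr_ge0// => j _; exact: sqr_ge0.
rewrite covariance.unlock.
rewrite -[fun w => tnth _ i]/(fi \o X 0%N) -[fun w => tnth _ i]/(fi \o X t).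
rewrite (stationary_expectation markovX revX t (mfi i)).
(* by stationarity both factors of the covariance are centred by the same [m] *)
set m := fine _; rewrite unlock.
have -> : t = (t./2 + t./2)%N by rewrite addnn even_halfK.
apply: (@even_lag_autocorrelation_ge0 _ _ _ _ _ _ _ _ markovX revX _
  (fun x => fi x - m)%R).
- by apply: measurable_funB; [exact: mfi|exact: measurable_cst].
- by apply: integral_sqrB_lty; [exact: mfiX|exact: fi_L2].
Qed.
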